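(* For every positive integer $n$, $$\sum_{\ell(\lambda)\le n}\binom{n}{m_0(\lambda),m_1(\lambda),\dots}\prod_{i=1}^n q_i^{\lambda_i}=\frac{\sum_{\sigma\in B_n}\prod_{i=1}^n q_i^{d_i(\sigma)+n_i(\sigma^{-1})}}{\prod_{i=1}^n(1-q_1^2\cdots q_i^2)}$$ in $\mathbf{Z}[[q_1,\dots,q_n]]$, where the sum on the left is over all partitions $\lambda=(\lambda_1,\dots,\lambda_n)$ with at most $n$ nonzero parts.
   Context: For a partition $\lambda=(\lambda_1\ge\dots\ge\lambda_n\ge0)$, $m_j(\lambda)=|\{1\le i\le n:\lambda_i=j\}|$, and the coefficient is the multinomial coefficient. $B_n$ is the group of signed permutations of $[-n,n]\setminus\{0\}$. For $\sigma\in B_n$: ${\it Des}(\sigma)=\{i\in[n-1]:\sigma(i)>\sigma(i+1)\}$, $d_i(\sigma)=|\{j\in{\it Des}(\sigma):j\ge i\}|$, ${\it Neg}(\sigma)=\{i\in[n]:\sigma(i)<0\}$, $n_i(\sigma)=|\{j\in{\it Neg}(\sigma):j\ge i\}|$. *)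

(* Defs.v *)
From HB Require Import structures.
From mathcomp Require Export all_boot all_order all_fingroup all_algebra.
From mathcomp Require Export boolp classical_sets cardinality fsbigop.
From mathcomp Require Export mpoly.

Set Implicit Arguments.
Unset Strict Implicit.
Unset Printing Implicit Defensive.

Import GRing.Theory.

Local Open Scope ring_scope.

(* Formal power series in n variables over R: arbitrary families of
   coefficients indexed by exponent vectors, with the Cauchy product. *)
Record fps (n : nat) (R : comNzRingType) : Type :=
  Fps { fps_coef : 'X_{1..n} -> R }.

Arguments Fps {n R} _.
Arguments fps_coef {n R} _ _.

Section FpsRing.
Variables (n : nat) (R : comNzRingType).
Implicit Types (p q r : fps n R) (m : 'X_{1..n}).

HB.instance Definition _ := gen_eqMixin (fps n R).
HB.instance Definition _ := gen_choiceMixin (fps n R).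

Lemma fpsP p q : (forall m, fps_coef p m = fps_coef q m) -> p = q.
Proof. by case: p q => [f] [g] /= /funext ->. Qed.

Definition fps0 : fps n R := Fps (fun=> 0).
Definition fpsC (c : R) : fps n R := Fps (fun m => if m == 0%MM then c else 0).
Definition fps_opp p : fps n R := Fps (fun m => - fps_coef p m).
Definition fps_add p q : fps n R := Fps (fun m => fps_coef p m + fps_coef q m).
Definition fps_mul p q : fps n R :=
  Fps (fun m => \sum_(k : 'X_{1..n < (mdeg m).+1, (mdeg m).+1}
                      | m == (k.1 + k.2)%MM) fps_coef p k.1 * fps_coef q k.2).

Fact fps_addA : associative fps_add.
Proof. by move=> p q r; apply: fpsP => m; apply: addrA. Qed.
Fact fps_addC : commutative fps_add.
Proof. by move=> p q; apply: fpsP => m; apply: addrC. Qed.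
Fact fps_add0 : left_id fps0 fps_add.
Proof. by move=> p; apply: fpsP => m; apply: add0r. Qed.
Fact fps_addN : left_inverse fps0 fps_opp fps_add.
Proof. by move=> p; apply: fpsP => m; apply: addNr. Qed.

HB.instance Definition _ :=
  GRing.isZmodule.Build (fps n R) fps_addA fps_addC fps_add0 fps_addN.

(* P agrees with p in all degrees < d; this transports the ring axioms of
   {mpoly R[n]} to power series. *)
Definition fps_approx d p (P : {mpoly R[n]}) :=
  forall m, (mdeg m < d)%N -> P@_m = fps_coef p m.

Definition fps_trunc d p : {mpoly R[n]} :=
  \sum_(m : 'X_{1..n < d}) fps_coef p m *: 'X_[m].

Lemma fps_truncP d p : fps_approx d p (fps_trunc d p).
Proof. by move=> m lt_md; rewrite mcoeff_mpoly. Qed.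

Lemma fps_approxM d p q P Q :
  fps_approx d p P -> fps_approx d q Q -> fps_approx d (fps_mul p q) (P * Q).
Proof.
move=> hp hq m lt_md; rewrite mcoeffM /=; apply: eq_bigr => k /eqP Em.
have lt_kd : (mdeg k.1 + mdeg k.2 < d)%N by rewrite -mdegD -Em.
by rewrite hp ?hq //; [apply: leq_ltn_trans lt_kd; apply: leq_addl
                       |apply: leq_ltn_trans lt_kd; apply: leq_addr].
Qed.

Lemma fps_approxC d c : fps_approx d (fpsC c) c%:MP.
Proof.
by move=> m _; rewrite mcoeffC /= eq_sym; case: eqP; rewrite ?mulr1 ?mulr0.
Qed.

Lemma fps_approxD d p q P Q :
  fps_approx d p P -> fps_approx d q Q -> fps_approx d (p + q) (P + Q).
Proof. by move=> hp hq m lt_md; rewrite mcoeffD hp ?hq. Qed.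

Lemma fps_approx_eq p q :
  (forall d, exists2 P, fps_approx d p P & fps_approx d q P) -> p = q.
Proof.
move=> h; apply: fpsP => m; have [P hp hq] := h (mdeg m).+1.
by rewrite -hp ?hq.
Qed.

Fact fps_mulA : associative fps_mul.
Proof.
move=> p q r; apply: fps_approx_eq => d.
exists (fps_trunc d p * (fps_trunc d q * fps_trunc d r)); last rewrite mulrA;
  by do !apply: fps_approxM; apply: fps_truncP.
Qed.

Fact fps_mulC : commutative fps_mul.
Proof.
move=> p q; apply: fps_approx_eq => d.
exists (fps_trunc d p * fps_trunc d q); last rewrite mulrC;
  by apply: fps_approxM; apply: fps_truncP.
Qed.

Fact fps_mul1 : left_id (fpsC 1) fps_mul.
Proof.
move=> p; apply: fps_approx_eq => d.
exists (1%:MP * fps_trunc d p); last by rewrite mul1r; apply: fps_truncP.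
by apply: fps_approxM; [apply: fps_approxC | apply: fps_truncP].
Qed.

Fact fps_mulDl : left_distributive fps_mul fps_add.
Proof.
move=> p q r; apply: fps_approx_eq => d.
exists ((fps_trunc d p + fps_trunc d q) * fps_trunc d r).
  by apply: fps_approxM; [apply: fps_approxD|]; apply: fps_truncP.
by rewrite mulrDl; apply: fps_approxD; apply: fps_approxM; apply: fps_truncP.
Qed.

Fact fps_1neq0 : fpsC 1 != 0 :> fps n R.
Proof.
apply/eqP => /(congr1 (fun p => fps_coef p 0%MM)) /= /eqP.
by rewrite eqxx oner_eq0.
Qed.

HB.instance Definition _ := GRing.Zmodule_isComNzRing.Build (fps n R)
  fps_mulA fps_mulC fps_mul1 fps_mulDl fps_1neq0.

(* Units are the invertible series and _^-1 is the (unique) inverse, extended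
   by the identity outside the units, as required by unitRingType. *)
Definition fps_unit : {pred fps n R} := fun p => `[< exists q, q * p = 1 >].

Definition fps_inv p : fps n R :=
  if pselect (exists q, q * p = 1) is left ex then projT1 (cid ex) else p.

Fact fps_mulVr : {in fps_unit, left_inverse 1 fps_inv *%R}.
Proof.
move=> p /asboolP ex; rewrite /fps_inv; case: pselect => // ex'.
by case: (cid ex').
Qed.

Fact fps_unitPl p q : q * p = 1 -> p \in fps_unit.
Proof. by move=> qp1; apply/asboolP; exists q. Qed.

Fact fps_inv_out : {in [predC fps_unit], fps_inv =1 id}.
Proof.
move=> p; rewrite inE => nex; rewrite /fps_inv; case: pselect => // ex.
by case/negP: nex; apply/asboolP.
Qed.

HB.instance Definition _ := GRing.ComNzRing_hasMulInverse.Build (fps n R)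
  fps_mulVr fps_unitPl fps_inv_out.

Lemma fps_coefD p q m : fps_coef (p + q) m = fps_coef p m + fps_coef q m.
Proof. by []. Qed.

Lemma fps_coefN p m : fps_coef (- p) m = - fps_coef p m.
Proof. by []. Qed.

Lemma fps_coef1 m : fps_coef (1 : fps n R) m = (m == 0%MM)%:R.
Proof. by rewrite /=; case: eqP. Qed.

Lemma fps_coefM p q m :
  fps_coef (p * q) m = \sum_(k : 'X_{1..n < (mdeg m).+1, (mdeg m).+1}
                         | m == (k.1 + k.2)%MM) fps_coef p k.1 * fps_coef q k.2.
Proof. by []. Qed.

Lemma fps_coef_sum (I : Type) (s : seq I) (P : pred I) (F : I -> fps n R) m :
  fps_coef (\sum_(i <- s | P i) F i) m = \sum_(i <- s | P i) fps_coef (F i) m.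
Proof. by elim/big_rec2: _ => // i x y _ <-. Qed.

Lemma fps_coefX_small p k m :
  fps_coef p 0%MM = 0 -> (mdeg m < k)%N -> fps_coef (p ^+ k) m = 0.
Proof.
move=> p0; elim: k m => // k IHk m lt_mk; rewrite exprS fps_coefM.
apply: big1 => [[k1 k2]] /= /eqP Em.
have [k1_0|k1_n0] := eqVneq (k1 : 'X_{1..n}) 0%MM; first by rewrite k1_0 p0 mul0r.
rewrite IHk ?mulr0 //.
have : (mdeg k1 + mdeg k2 < k.+1)%N by rewrite -mdegD -Em.
rewrite ltnS; apply: leq_trans; rewrite -add1n leq_add2r lt0n mdeg_eq0 //.
Qed.

Lemma fps_unit_coef1 p : fps_coef p 0%MM = 1 -> p \is a GRing.unit.
Proof.
move=> p0; pose x := 1 - p.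
have x0 : fps_coef x 0%MM = 0 by rewrite fps_coefD fps_coefN fps_coef1 eqxx p0 subrr.
pose g d := \sum_(k < d) x ^+ k.
pose q : fps n R := Fps (fun m => fps_coef (g (mdeg m).+1) m).
have qg d m : (mdeg m < d)%N -> fps_coef q m = fps_coef (g d) m.
  move=> lt_md; rewrite /= !fps_coef_sum (big_ord_widen _ (fun k => fps_coef (x ^+ k) m) lt_md).
  rewrite [RHS](bigID (fun k : 'I_d => (k < (mdeg m).+1)%N)) /=.
  rewrite [X in _ = _ + X]big1 ?addr0 // => k; rewrite -leqNgt.
  exact: fps_coefX_small.
apply: (@fps_unitPl _ q); apply: fpsP => m; set d := (mdeg m).+1.
have -> : fps_coef (q * p) m = fps_coef (g d * p) m.
  rewrite !fps_coefM; apply: eq_bigr => [[k1 k2]] /= /eqP Em; congr (_ * _).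
  exact: (qg d k1 (bmdeg k1)).
have -> : g d * p = 1 - x ^+ d.
  by rewrite -[RHS]opprB subrX1 -mulNr opprB -[p in LHS](subKr 1) mulrC.
by rewrite fps_coefD fps_coefN (fps_coefX_small x0) // subr0.
Qed.

End FpsRing.

Definition fpsX {n : nat} {R : comNzRingType} (i : 'I_n) : fps n R :=
  Fps (fun m => (m == U_(i)%MM)%:R).

(* Possibly infinite sums of power series, taken coefficient by coefficient.
   A family is summable when only finitely many terms contribute to each
   coefficient; the finite-support sum \sum_(i \in D) is 0 otherwise. *)
Definition fps_summable (n : nat) (R : comNzRingType) (I : choiceType)
    (D : set I) (F : I -> fps n R) : Prop :=
  forall m, finite_set [set i | D i /\ fps_coef (F i) m <> 0].

Definition fps_infsum (n : nat) (R : comNzRingType) (I : choiceType)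
    (D : set I) (F : I -> fps n R) : fps n R :=
  Fps (fun m => \sum_(i \in D) fps_coef (F i) m).

(* Indices in [n] are shifted to 'I_n = {0, ..., n-1} throughout. *)

Section Partitions.
Variable n : nat.
Implicit Type la : n.-tuple nat.

Definition partitions : set (n.-tuple nat) :=
  [set la : n.-tuple nat | sorted geq la]%classic.

Definition part_mult la (j : nat) : nat := #|[set i : 'I_n | tnth la i == j]|.

(* The multinomial coefficient n! / (m_0! m_1! ...); factors with j > max la
   are 0! = 1, and the division is exact. *)
Definition part_multinomial la : nat :=
  n`! %/ \prod_(0 <= j < (\max_(i < n) tnth la i).+1) (part_mult la j)`!.

End Partitions.

Section SignedPermutations.
Variable n : nat.

(* (false, i) stands for i + 1 and (true, i) for - (i + 1), so that this is
   the set [-n, n] \ {0}. *)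
Definition signed : finType := (bool * 'I_n)%type.

Definition signed_val (x : signed) : int :=
  if x.1 then - (x.2.+1)%:Z else (x.2.+1)%:Z.

Definition signed_opp (x : signed) : signed := (~~ x.1, x.2).

Definition hyperoctahedral : {set {perm signed}} :=
  [set s : {perm signed} | [forall x, s (signed_opp x) == signed_opp (s x)]].

Fact hyperoctahedral_group_set : group_set hyperoctahedral.
Proof.
apply/group_setP; split=> [|s t]; rewrite !inE.
  by apply/forallP => x; rewrite !perm1.
move=> /forallP hs /forallP ht; apply/forallP => x.
by rewrite !permM (eqP (hs x)) (eqP (ht _)).
Qed.
Canonical hyperoctahedral_group := Group hyperoctahedral_group_set.

Implicit Type s : {perm signed}.

Definition window s (i : 'I_n) : int := signed_val (s (false, i)).

Definition Des s : {set 'I_n} :=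
  [set i : 'I_n | [exists j : 'I_n, (j == i.+1 :> nat) && (window s j < window s i)]].
Definition des_from s (i : 'I_n) : nat := #|[set j in Des s | (i <= j)%N]|.

Definition Neg s : {set 'I_n} := [set i : 'I_n | window s i < 0].
Definition neg_from s (i : 'I_n) : nat := #|[set j in Neg s | (i <= j)%N]|.

End SignedPermutations.

Arguments hyperoctahedral n : clear implicits.
Arguments partitions n : clear implicits.

Lemma signed_val_inj n : injective (@signed_val n).
Proof.
by case=> [[] i] [[] j] /eqP; rewrite /signed_val /= ?eqr_opp // => /eqP [] /val_inj ->.
Qed.

Lemma signed_valN n (x : signed n) : signed_val (signed_opp x) = - signed_val x.
Proof. by case: x => [[] i]; rewrite /signed_val /= ?opprK. Qed.

Lemma fps_coef_monomial n (R : comNzRingType) (e : 'I_n -> nat) m :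
  fps_coef (\prod_(i < n) fpsX i ^+ e i : fps n R) m
  = (m == [multinom e i | i < n])%:R.
Proof.
set d := (mdeg m).+1.
have hX i : fps_approx d (fpsX i : fps n R) 'X_i.
  by move=> k _; rewrite mcoeffX eq_sym.
have h1 : fps_approx d (1 : fps n R) 1 by exact: (@fps_approxC n R d 1).
have hXn i k : fps_approx d (fpsX i ^+ k : fps n R) ('X_i ^+ k).
  by elim: k => // k IHk; rewrite !exprS; apply: fps_approxM.
have h : fps_approx d (\prod_(i < n) fpsX i ^+ e i : fps n R)
                      (\prod_(i < n) 'X_i ^+ e i).
  by apply: (big_ind2 (fps_approx d)) => // *; apply: fps_approxM.
rewrite -h // eq_sym -mcoeffX mpolyXE_id; congr (_@_m).
by apply: eq_bigr => i _; rewrite mnmE.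
Qed.

(* Distinct partitions contribute to distinct monomials, so the sum over all
   partitions is a genuine one. *)
Lemma part_summable n (D : set (n.-tuple nat)) :
  fps_summable D (fun la : n.-tuple nat =>
    (part_multinomial la)%:R * \prod_(i < n) fpsX i ^+ tnth la i : fps n int).
Proof.
move=> m; apply: (@sub_finite_set _ _ [set [tuple m i | i < n]]%classic);
  last exact: finite_set1.
move=> la [_]; rewrite mulr_natl => nz; apply: eq_from_tnth => i.
rewrite tnth_mktuple; case: (m =P [multinom tnth la i | i < n]) => [->|ne].
  by rewrite mnmE.
case: nz; elim: (part_multinomial la) => // k IHk.
by rewrite mulrS fps_coefD IHk addr0 fps_coef_monomial; case: eqP.
Qed.

Lemma denominator_unit n :
  \prod_(i < n) (1 - \prod_(j < n | (j <= i)%N) fpsX j ^+ 2) \is a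
    @GRing.unit (fps n int).
Proof.
apply: rpred_prod => i _; apply: fps_unit_coef1.
rewrite fps_coefD fps_coefN fps_coef1 eqxx.
suff -> : fps_coef (\prod_(j < n | (j <= i)%N) fpsX j ^+ 2 : fps n int) 0%MM = 0.
  by rewrite subr0.
have -> : \prod_(j < n | (j <= i)%N) fpsX j ^+ 2
  = \prod_(j < n) fpsX j ^+ (if (j <= i)%N then 2 else 0) :> fps n int.
  by rewrite big_mkcond; apply: eq_bigr => j _; case: ifP.
rewrite fps_coef_monomial; case: eqP => // /(congr1 (fun u => (u : 'X_{1..n}) i)).
by rewrite !mnmE leqnn.
Qed.

(* Main.v *)
(** Write Q_i = q_1 ... q_i, and let S be the sum of the monomials of all
    partitions with at most n parts.  Multiplying by Q_i forces a strict step
    after the i-th part, and multiplying by 1 - Q_i forces an equality there;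
    hence S is the inverse of the product of the 1 - Q_i, and Q^D S, with Q^D
    the product of the Q_i for i in D, is the sum of the monomials of the
    partitions with strict steps at D.

    A signed permutation is a pair (A, u), where A is the set of absolute values
    taken with a negative sign and u is an ordinary permutation: its numerator
    term is Q^A Q^D, where D is the descent set of g o u for the injection g
    that puts the signs A on [n].  For fixed A, the coefficient of q^la in the
    sum over u of Q^D S counts the u such that g o u descends only at strict
    steps of la.  These u are in bijection with the rearrangements la o u^-1 of
    la, whatever g is, so their number is the multinomial coefficient.  Finally,
    summing Q^A over A gives the product of the 1 + Q_i. *)
Require Import Defs.
From mathcomp Require Import zify.
Import GRing.Theory Num.Theory.
Local Open Scope ring_scope.
Set Implicit Arguments.
Unset Strict Implicit.
Unset Printing Implicit Defensive.

(** * Series of partitions with prescribed strict and flat steps *)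

Section StaircaseSeries.
Local Notation set0 := finset.set0.
Local Notation setT := [set: _]%SET.
Variables (n : nat) (R : comNzRingType).
Implicit Types (m : 'X_{1..n}) (D Z : {set 'I_n}) (i j : 'I_n).

Lemma fps_coef_monomialM (e : 'I_n -> nat) (p : fps n R) m :
  let a := [multinom e i | i < n] in
  fps_coef ((\prod_(i < n) fpsX i ^+ e i) * p) m
  = if (a <= m)%MM then fps_coef p (m - a)%MM else 0.
Proof.
move=> a; rewrite fps_coefM.
under eq_bigr do rewrite fps_coef_monomial -/a.
case: ifP => [le_am | nle_am]; last first.
  apply: big1 => -[k1 k2] /= /eqP Em; case: eqP => [Ea|]; last by rewrite mul0r.
  by rewrite Em -Ea lem_addr // lexx in nle_am.
have lt_a : (mdeg a < (mdeg m).+1)%N.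
  by rewrite -(submK le_am) mdegD ltnS leq_addl.
have lt_b : (mdeg (m - a)%MM < (mdeg m).+1)%N.
  by rewrite -[in X in (_ < X)%N](submK le_am) mdegD ltnS leq_addr.
rewrite (bigD1 (BMultinom lt_a, BMultinom lt_b)) /=; last by rewrite addmC submK.
rewrite eqxx mul1r big1 ?addr0 // => -[k1 k2] /= /andP[/eqP Em].
have [Ea|_] := eqVneq (bmnm k1) a; last by rewrite mul0r.
have Eb : bmnm k2 = (m - a)%MM by rewrite [in RHS]Em -Ea addmC addmK.
by case/eqP; congr (_, _); apply: val_inj.
Qed.

(* Extended by 0 past the last variable, so that the last part also has a step,
   down to 0. *)
Definition mnm_ext m (k : nat) : nat := oapp m 0%N (insub k).

Lemma mnm_ext_ord m i : mnm_ext m i = m i.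
Proof. by rewrite /mnm_ext valK. Qed.

(** Strict steps [D] record multiplication by Q_i, flat steps [Z] multiplication by 1 - Q_i; with
    both empty these are the exponents of partitions. *)
Definition staircase D Z m : bool :=
  [forall j : 'I_n, (mnm_ext m j.+1 + (j \in D) <= mnm_ext m j)%N
     && ((j \in Z) ==> (mnm_ext m j.+1 == mnm_ext m j))].

Definition staircase_fps D Z : fps n R := Fps (fun m => (staircase D Z m)%:R).

Definition step_fps i : fps n R := \prod_(j < n | (j <= i)%N) fpsX j.

Lemma step_fpsE i : step_fps i = \prod_(j < n) fpsX j ^+ (j <= i)%N.
Proof. by rewrite /step_fps big_mkcond; apply: eq_bigr => j _; case: ifP. Qed.

Lemma staircase_antitone D Z m i j :
  staircase D Z m -> (i <= j)%N -> (m j <= m i)%N.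
Proof.
move=> /forallP mDZ; rewrite -!mnm_ext_ord; case: j => /= j.
elim: j => [|j IHj] lt_jn; first by rewrite leqn0 => /eqP ->.
rewrite leq_eqVlt => /predU1P[-> //|]; rewrite ltnS => /(IHj (ltnW lt_jn)).
apply: leq_trans; have /andP[] := mDZ (Ordinal (ltnW lt_jn)).
by move=> le_j _; apply: leq_trans le_j; apply: leq_addr.
Qed.

Lemma staircase_setP m :
  reflect {homo m : i j / (i <= j)%N >-> (j <= i)%N} (staircase set0 set0 m).
Proof.
apply: (iffP idP) => [mS i j|m_anti]; first exact: (staircase_antitone mS).
apply/forallP => j; rewrite !inE addn0 andbT mnm_ext_ord /mnm_ext.
by case: insubP => //= k _ Ek; apply: m_anti; rewrite Ek.
Qed.

(** Multiplying by Q_i adds 1 to the parts up to index [i], which raises the step at [i] by one and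
    leaves all other steps unchanged. *)
Lemma step_fps_staircase D Z i : i \notin D -> i \notin Z ->
  step_fps i * staircase_fps D Z = staircase_fps (i |: D) Z.
Proof.
move=> iD iZ; apply: fpsP => m; rewrite step_fpsE fps_coef_monomialM /=.
set a := [multinom _ | _ < n].
have le_am : staircase (i |: D) Z m -> (a <= m)%MM.
  move=> mS; apply/mnm_lepP => k; rewrite mnmE; case: (leqP k i) => //= le_ki.
  apply: leq_trans _ (staircase_antitone mS le_ki).
  have /forallP/(_ i)/andP[] := mS; rewrite setU11 mnm_ext_ord => + _.
  by apply: leq_trans; rewrite addn1.
case: ifPn => [le | nle]; last first.
  by case: (boolP (staircase _ _ _)) => // /le_am; rewrite (negPf nle).
congr (_%:R); congr (nat_of_bool _); apply: eq_forallb => j.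
have extE k : mnm_ext (m - a) k = (mnm_ext m k - (k <= i))%N.
  rewrite /mnm_ext; case: insubP => //= k' _ <-.
  by rewrite mnmBE mnmE.
(* This makes the truncated subtraction in [extE] exact. *)
have ext_ge k : ((k <= i) <= mnm_ext m k)%N.
  case: (leqP k i) => //= le_ki; have lt_kn := leq_ltn_trans le_ki (ltn_ord i).
  rewrite -[k]/(nat_of_ord (Ordinal lt_kn)) mnm_ext_ord.
  by have := mnm_lepP le (Ordinal lt_kn); rewrite mnmE /= le_ki.
rewrite !extE; have := ext_ge j; have := ext_ge j.+1; rewrite !inE.
have [-> | ne_ji] := eqVneq j i.
  by rewrite leqnn ltnn (negPf iD) (negPf iZ) /=; lia.
have -> : (j < i)%N = (j <= i)%N.
  by rewrite ltn_neqAle -[j == i :> nat]/(j == i) ne_ji.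
by case: (j <= i)%N; case: (j \in D); case: (j \in Z) => /=; lia.
Qed.

(** A step at [i] is either strict or flat, and Q_i times the series accounts for the strict
    case. *)
Lemma subr_step_fps_staircase D Z i : i \notin D -> i \notin Z ->
  (1 - step_fps i) * staircase_fps D Z = staircase_fps D (i |: Z).
Proof.
move=> iD iZ; rewrite mulrBl mul1r step_fps_staircase //.
apply/eqP; rewrite subr_eq; apply/eqP/fpsP => m; rewrite fps_coefD /= -natrD.
congr (_%:R); set eq_i := mnm_ext m i.+1 == mnm_ext m i.
have -> : staircase D (i |: Z) m = staircase D Z m && eq_i.
  apply/forallP/andP => [mS|[/forallP mS eq_mi] j].
    split; last by have /andP[_] := mS i; rewrite setU11.
    apply/forallP => j; have := mS j; rewrite !inE.
    by case: (j \in Z); rewrite ?orbT ?andbT // => /andP[->].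
  have /andP[-> le_Z] := mS j; rewrite !inE.
  by case: eqVneq => [->|_] /=; [exact: eq_mi | exact: le_Z].
have -> : staircase (i |: D) Z m = staircase D Z m && ~~ eq_i.
  apply/forallP/andP => [mS|[/forallP mS ne_mi] j].
    split; last first.
      by have /andP[+ _] := mS i; rewrite setU11 addn1 neq_ltn => ->.
    apply/forallP => j; have /andP[+ ->] := mS j; rewrite andbT !inE.
    by apply: leq_trans; rewrite leq_add2l; case: (j \in D); rewrite ?orbT.
  have /andP[le_D ->] := mS j; rewrite andbT !inE; move: le_D.
  case: eqVneq => [->|//]; rewrite (negPf iD) addn0 addn1 => le_mi.
  by rewrite ltn_neqAle ne_mi.
by case: (staircase D Z m); case: eq_i.
Qed.

Lemma staircase_fps_setT : staircase_fps set0 setT = 1.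
Proof.
apply: fpsP => m; rewrite fps_coef1 /=; congr (_%:R); congr (nat_of_bool _).
apply/forallP/eqP => [mS|-> j]; last first.
  by rewrite !inE addn0 /mnm_ext; do 2!case: insubP => /= *; rewrite ?mnm0E.
(* Flatness carries the value 0 past the last part back to every part, by induction on [n - k]. *)
have const_m k : (k <= n)%N -> mnm_ext m k = 0%N.
  move=> le_kn; rewrite -(subKn le_kn).
  elim: (n - k)%N => [|d IHd] in le_kn *.
    by rewrite subn0 /mnm_ext insubN // ltnn.
  case: (ltnP d n) => [lt_dn|le_nd]; last first.
    by rewrite -IHd //; congr mnm_ext; lia.
  have lt_n : (n - d.+1 < n)%N by lia.
  have /andP[_] := mS (Ordinal lt_n); rewrite inE /= => /eqP <-.
  by rewrite subnSK // IHd.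
by apply/mnmP => i; rewrite mnmE -mnm_ext_ord const_m // ltnW.
Qed.

Lemma prod_step_fps_staircase D :
  (\prod_(i in D) step_fps i) * staircase_fps set0 set0 = staircase_fps D set0.
Proof.
move: {2}#|D| (erefl #|D|) => k; elim: k => [|k IHk] in D *.
  by move/eqP; rewrite cards_eq0 => /eqP ->; rewrite big_set0 mul1r.
case: (set_0Vmem D) => [->|[i Di]] cardD; first by rewrite cards0 in cardD.
rewrite (big_setD1 i) //= -mulrA IHk; last first.
  by move: cardD; rewrite (cardsD1 i) Di => -[].
by rewrite step_fps_staircase ?finset.setD1K ?inE ?eqxx.
Qed.

Lemma prod_subr_step_fps_staircase :
  (\prod_i (1 - step_fps i)) * staircase_fps set0 set0 = 1.
Proof.
suff gen Z : (\prod_(i in Z) (1 - step_fps i)) * staircase_fps set0 set0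
    = staircase_fps set0 Z.
  rewrite -[RHS]staircase_fps_setT -[RHS]gen; congr (_ * _).
  by rewrite [RHS](eq_bigl xpredT) // => i; rewrite inE.
move: {2}#|Z| (erefl #|Z|) => k; elim: k => [|k IHk] in Z *.
  by move/eqP; rewrite cards_eq0 => /eqP ->; rewrite big_set0 mul1r.
case: (set_0Vmem Z) => [->|[i Zi]] cardZ; first by rewrite cards0 in cardZ.
rewrite (big_setD1 i) //= -mulrA IHk; last first.
  by move: cardZ; rewrite (cardsD1 i) Zi => -[].
by rewrite subr_step_fps_staircase ?finset.setD1K ?inE ?eqxx.
Qed.

End StaircaseSeries.

(** * Counting the rearrangements of a word *)

Lemma count_mem_rem (T : eqType) (x y : T) (s : seq T) :
  count_mem y (rem x s) = (count_mem y s - ((x \in s) && (x == y)))%N.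
Proof.
have [xs|xs] := boolP (x \in s); last by rewrite rem_id // subn0.
by have /seq.permP -> := perm_to_rem xs; rewrite /= addKn.
Qed.

(** Induction on the length, splitting the rearrangements by first letter. The alphabet [r] stays
    fixed when a letter is removed; absent letters contribute 0! = 1. *)
Lemma size_permutations_multinomial (T : eqType) (s r : seq T) :
  uniq r -> {subset s <= r} ->
  (size (permutations s) * \prod_(x <- r) (count_mem x s)`! = (size s)`!)%N.
Proof.
move=> r_uniq; move: {2}(size s) (erefl (size s)) => k.
elim: k => [|k IHk] in s * => size_s sub_sr.
  by rewrite (size0nil size_s) /= mul1n big1 // => x _.
have s_gt0 : (0 < size s)%N by rewrite size_s.
rewrite (perm_size (permutationsE s_gt0)) size_allpairs_dep sumnE big_map.
rewrite big_distrl /= size_s factS -size_s.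
have -> : size s = (\sum_(x <- undup s) count_mem x s)%N.
  by rewrite -[LHS](perm_size (perm_count_undup s)) size_flatten /shape -map_comp
    sumnE big_map; apply: eq_bigr => x _; rewrite /= size_nseq.
rewrite big_distrl /=; apply: eq_big_seq => x; rewrite mem_undup => xs.
have rem_k : size (rem x s) = k by rewrite size_rem // size_s.
rewrite -[in RHS]rem_k -IHk //; last by move=> y /mem_rem/sub_sr.
rewrite mulnCA; congr muln; rewrite (bigD1_seq x) ?sub_sr //=.
rewrite [in RHS](bigD1_seq x) ?sub_sr //= mulnA; congr muln.
  have : (0 < count_mem x s)%N by rewrite -has_count has_pred1.
  rewrite count_mem_rem xs eqxx subn1.
  by case: (count_mem x s) => // c _; rewrite factS.
by apply: eq_bigr => y /negPf ne; rewrite count_mem_rem xs eq_sym ne subn0.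
Qed.

(** * Permutations whose descents lie at strict steps *)

Section SortedWords.
Variables (n : nat) (x0 : 'I_n) (g : 'I_n -> int).
Hypothesis g_inj : injective g.
Implicit Types (m : 'X_{1..n}) (u v : 'S_n) (f : 'I_n -> nat).

Definition word_des u : {set 'I_n} :=
  [set i : 'I_n | [exists j : 'I_n, (j == i.+1 :> nat) && (g (u j) < g (u i))]].

(** Decreasing [f], ties broken by increasing [g]; injectivity of [g] makes this a total order. *)
Definition word_rel f : rel 'I_n :=
  fun x y => (f y < f x)%N || (f x == f y) && (g x <= g y).

Lemma word_rel_total f : total (word_rel f).
Proof. by move=> x y; rewrite /word_rel; lia. Qed.

Lemma word_rel_trans f : transitive (word_rel f).
Proof. by move=> y x z; rewrite /word_rel; lia. Qed.

Lemma word_rel_anti f : antisymmetric (word_rel f).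
Proof.
by move=> x y le_xy; apply: g_inj; move: le_xy; rewrite /word_rel; lia.
Qed.

(** Between neighbours, [word_rel] asks for a strict drop of [m], or equality without a descent of
    [g \o u]. For antitone [m] this says that descents occur only at strict steps. *)
Lemma sorted_word_rel m u f :
  (forall i, f (u i) = m i) -> {homo m : i j / (i <= j)%N >-> (j <= i)%N} ->
  sorted (word_rel f) [seq u i | i <- enum 'I_n]
  = staircase (word_des u) finset.set0 m.
Proof.
move=> fu m_anti.
have nth_u (i : 'I_n) : nth x0 [seq u i | i <- enum 'I_n] i = u i.
  by rewrite (nth_map x0) ?size_enum_ord // nth_ord_enum.
have size_u : size [seq u i | i <- enum 'I_n] = n by rewrite size_map size_enum_ord.
have desE (j k : 'I_n) : k = j.+1 :> nat -> (j \in word_des u) = (g (u k) < g (u j)).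
  move=> Ek; rewrite inE; apply/existsP/idP => [[k' /andP[/eqP Ek']]|lt_g].
    by have -> : k' = k by apply: val_inj; rewrite /= Ek'.
  by exists k; rewrite Ek eqxx.
have stepE (j k : 'I_n) : k = j.+1 :> nat ->
    word_rel f (u j) (u k) = (m k + (j \in word_des u) <= m j)%N.
  move=> Ek; rewrite (desE j k Ek) /word_rel !fu.
  have := m_anti j k; rewrite Ek => /(_ (leqnSn _)); lia.
apply/(sortedP x0)/forallP => [u_sorted j | mS i]; rewrite ?size_u.
  rewrite finset.in_set0 andbT mnm_ext_ord; case: (ltnP j.+1 n) => [lt_jn|le_nj].
    rewrite -[j.+1]/(nat_of_ord (Ordinal lt_jn)) mnm_ext_ord -stepE //.
    have := u_sorted j.
    by rewrite size_u -[j.+1]/(nat_of_ord (Ordinal lt_jn)) !nth_u; apply.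
  (* The last position has no successor, hence no descent, and its step goes down to 0. *)
  rewrite /mnm_ext insubN -?leqNgt //= inE.
  case: existsP => // -[k /andP[/eqP Ek _]].
  by have := ltn_ord k; rewrite Ek ltnNge le_nj.
move=> lt_in; have := mS (Ordinal (ltnW lt_in)); rewrite finset.in_set0 andbT mnm_ext_ord.
rewrite -[(Ordinal (ltnW lt_in)).+1]/(nat_of_ord (Ordinal lt_in)) mnm_ext_ord -stepE //.
by rewrite -[i]/(nat_of_ord (Ordinal (ltnW lt_in))) !nth_u.
Qed.

Lemma perm_map_perm u : perm_eq [seq u i | i <- enum 'I_n] (enum 'I_n).
Proof.
apply: uniq_perm; rewrite ?enum_uniq ?(map_inj_uniq perm_inj) ?enum_uniq // => x.
by rewrite mem_enum; apply/mapP; exists (u^-1%g x); rewrite ?mem_enum ?permKV.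
Qed.

(* u is recovered from the word [m \o u^-1] by sorting the positions, first by
   decreasing letter and then by increasing [g]. *)
Lemma card_word_des m : {homo m : i j / (i <= j)%N >-> (j <= i)%N} ->
  #|[set u : 'S_n | staircase (word_des u) finset.set0 m]|
  = size (permutations [seq m i | i <- enum 'I_n]).
Proof.
move=> m_anti; set X := [set u | _].
pose word u := [seq m (u^-1%g i) | i <- enum 'I_n].
have word_inj : {in enum X &, injective word}.
  move=> u v; rewrite !mem_enum !inE => uX vX /eq_in_map Euv.
  (* Equal words give the same [f], so [u] and [v] both list the indices in the same [word_rel f]
     order. *)
  pose f i := m (u^-1%g i).
  have fu i : f (u i) = m i by rewrite /f permK.
  have fv i : f (v i) = m i by rewrite /f Euv ?permK ?mem_enum.
  rewrite -(sorted_word_rel fu) // in uX; rewrite -(sorted_word_rel fv) // in vX.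
  have /eq_in_map Ecodom := sorted_eq (@word_rel_trans f) (@word_rel_anti f) uX vX
    (perm_trans (perm_map_perm u) (etrans (perm_sym _ _) (perm_map_perm v))).
  by apply/permP => i; apply: Ecodom; rewrite mem_enum.
rewrite cardE -(size_map word); apply: perm_size.
apply: uniq_perm; first by rewrite map_inj_in_uniq ?enum_uniq.
  exact: permutations_uniq.
move=> t; rewrite mem_permutations; apply/mapP/idP => [[u _ ->]|t_perm].
  by rewrite /word (map_comp m) perm_map // perm_map_perm.
have size_t : size t = n by rewrite (perm_size t_perm) size_map size_enum_ord.
(* Surjectivity: the preimage of [t] is the permutation that sorts the positions of [t] by
   [word_rel f]. *)
pose f (i : 'I_n) := nth 0%N t i.
pose s := sort (word_rel f) (enum 'I_n).
have size_s : size s = n by rewrite size_sort size_enum_ord.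
have nth_inj : injective (fun i : 'I_n => nth i s i).
  move=> i j; rewrite (set_nth_default j) ?size_s // => /eqP.
  by rewrite nth_uniq ?size_s ?sort_uniq ?enum_uniq // => /eqP /val_inj.
pose u := perm nth_inj.
have Es : [seq u i | i <- enum 'I_n] = s.
  apply: (@eq_from_nth _ x0) => [|i]; rewrite size_map size_enum_ord ?size_s // => lt_in.
  rewrite (nth_map x0) ?size_enum_ord // permE -[i]/(nat_of_ord (Ordinal lt_in)).
  by rewrite nth_ord_enum; apply: set_nth_default; rewrite size_s.
have s_sorted : sorted (word_rel f) s by apply: sort_sorted; apply: word_rel_total.
(* Both sides are weakly decreasing rearrangements of [t], hence equal. *)
have Ef : [seq f i | i <- s] = [seq m i | i <- enum 'I_n].
  apply: (@sorted_eq _ geq).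
  - by move=> y x z /= le_yx le_zy; apply: leq_trans le_yx.
  - by move=> x y; rewrite /= -eqn_leq => /eqP.
  - rewrite sorted_map; apply: sub_sorted s_sorted => x y.
    by rewrite /word_rel /=; lia.
  - rewrite sorted_map; apply/(sortedP x0) => i; rewrite size_enum_ord => lt_in.
    by apply: m_anti; rewrite !nth_enum_ord // ltnW.
  - have -> : [seq f i | i <- s] = [seq nth 0%N t i | i <- [seq val i | i <- s]].
      by rewrite -map_comp.
    rewrite (perm_trans _ t_perm) // -[X in perm_eq _ X](mkseq_nth 0%N) size_t perm_map //.
    by rewrite -val_enum_ord perm_map // perm_sort.
have fu i : f (u i) = m i.
  move: Ef; rewrite -Es -map_comp => /eq_in_map/(_ i); rewrite mem_enum.
  by move=> /(_ isT).
exists u; first by rewrite mem_enum inE -(sorted_word_rel fu) // Es.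
apply: (@eq_from_nth _ 0%N) => [|i lt_it]; first by rewrite size_map size_enum_ord.
have lt_in : (i < n)%N by rewrite -size_t.
rewrite (nth_map (Ordinal lt_in)) ?size_enum_ord //.
rewrite -[i]/(nat_of_ord (Ordinal lt_in)) nth_ord_enum.
by rewrite -fu permKV.
Qed.

End SortedWords.

(** * Coefficients of the partition series *)

Lemma part_multinomialE n (la : n.-tuple nat) :
  part_multinomial la = size (permutations la).
Proof.
rewrite /part_multinomial; set M := (\max_(i < n) tnth la i)%N.
have sub_iota : {subset la <= index_iota 0 M.+1}.
  by move=> _ /tnthP[i ->]; rewrite mem_index_iota ltnS leq_bigmax.
rewrite -[in n`!](size_tuple la).
rewrite -(size_permutations_multinomial (iota_uniq _ _) sub_iota).
rewrite [X in (_ %/ X)%N](eq_bigr (fun j => (count_mem j la)`!)) => [|j _].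
  by rewrite mulnK // prodn_gt0 // => j; apply: fact_gt0.
congr (_`!); rewrite /part_mult cardsE cardE /enum_mem size_filter.
rewrite -[in RHS](map_tnth_enum la) count_map.
by rewrite enumT; apply: eq_count.
Qed.

Lemma fps_coef_natM n (R : comNzRingType) k (p : fps n R) m :
  fps_coef (k%:R * p) m = k%:R * fps_coef p m.
Proof. by rewrite !mulr_natl; elim: k => // k IHk; rewrite !mulrS fps_coefD IHk. Qed.

Definition partition_fps n : fps n int :=
  fps_infsum (partitions n)
    (fun la => (part_multinomial la)%:R * \prod_(i < n) fpsX i ^+ tnth la i).

(** Only the tuple of exponents of [m] can contribute, and it is a partition exactly when [m] is
    antitone. *)
Lemma fps_coef_partition_fps n (m : 'X_{1..n}) :
  fps_coef (partition_fps n) m = if staircase finset.set0 finset.set0 m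
    then (size (permutations [seq m i | i <- enum 'I_n]))%:R else 0.
Proof.
pose t := [tuple m i | i < n].
have coefE (la : n.-tuple nat) : fps_coef ((part_multinomial la)%:R
    * \prod_(i < n) fpsX i ^+ tnth la i : fps n int) m
    = if la == t then (part_multinomial t)%:R else 0.
  rewrite fps_coef_natM fps_coef_monomial; have [->|ne] := eqVneq la t.
    rewrite [X in m == X](_ : _ = m) ?eqxx ?mulr1 //.
    by apply/mnmP => i; rewrite mnmE tnth_mktuple.
  case: eqP => [Em|]; last by rewrite mulr0.
  by case/eqP: ne; apply: eq_from_tnth => i; rewrite tnth_mktuple Em mnmE.
have sortedE : sorted geq t = staircase finset.set0 finset.set0 m.
  have nth_t (i : 'I_n) : nth 0%N t i = m i by rewrite -tnth_nth tnth_mktuple.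
  apply/idP/staircase_setP => [t_sorted i j le_ij|m_anti].
    rewrite -!nth_t.
    apply: (sorted_leq_nth _ _ 0%N t_sorted); rewrite ?inE ?size_tuple //.
      by move=> y x z /= le_yx le_zy; apply: leq_trans le_yx.
    exact: leqnn.
  apply/(sortedP 0%N) => i; rewrite size_tuple => lt_in.
  rewrite -[i]/(nat_of_ord (Ordinal (ltnW lt_in))) nth_t.
  rewrite -[(Ordinal (ltnW lt_in)).+1]/(nat_of_ord (Ordinal lt_in)) nth_t.
  exact: m_anti.
rewrite -[fps_coef _ m]/(\sum_(la \in partitions n) fps_coef _ m).
case: ifP => [mS|nmS].
  rewrite -(@fsbig_widen _ _ _ _ [set t]%classic); first last.
  - by move=> la [_ /= ne_la]; apply: etrans (coefE la) _; case: eqP.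
  - by move=> _ ->; rewrite /partitions /= sortedE.
  rewrite fsbig_set1 coefE eqxx part_multinomialE.
  by congr (size (permutations _))%:R.
apply: fsbig1 => la la_sorted; rewrite coefE; case: eqP => // Et.
by rewrite -sortedE -Et la_sorted in nmS.
Qed.

(** * Descent generating function for a fixed set of signs *)

Lemma prod_expr_card_from n (D : {set 'I_n}) :
  \prod_(i < n) fpsX i ^+ #|[set j in D | (i <= j)%N]|
  = \prod_(j in D) step_fps int j.
Proof.
rewrite /step_fps (exchange_big_dep predT) //=; apply: eq_bigr => i _.
by rewrite -prodr_const; apply: eq_bigl => j; rewrite inE.
Qed.

(** By [card_word_des] each coefficient counts rearrangements, so the sum does not depend on [g]. *)
Lemma sum_word_des_staircase n (x0 : 'I_n) (g : 'I_n -> int) : injective g ->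
  \sum_(u : 'S_n) staircase_fps int (word_des g u) finset.set0 = partition_fps n.
Proof.
move=> g_inj; apply: fpsP => m; rewrite fps_coef_partition_fps // fps_coef_sum /=.
rewrite -natr_sum; case: ifP => [/staircase_setP m_anti|/negP nmS].
  rewrite -(card_word_des x0 g_inj m_anti) -sum1_card [in RHS]big_mkcond /=.
  by congr (_%:R); apply: eq_bigr => u _; rewrite inE; case: (staircase _ _ _).
rewrite big1 // => u _; case: (boolP (staircase _ _ _)) => // /staircase_antitone.
by move/staircase_setP.
Qed.

Lemma sum_word_des n (x0 : 'I_n) (g : 'I_n -> int) : injective g ->
  \sum_(u : 'S_n) \prod_(j in word_des g u) step_fps int j
  = partition_fps n * \prod_(i < n) (1 - step_fps int i).
Proof.
move=> g_inj; rewrite -(sum_word_des_staircase x0 g_inj).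
under [in RHS]eq_bigr do rewrite -prod_step_fps_staircase.
by rewrite -mulr_suml -mulrA [_ * \prod_i _]mulrC prod_subr_step_fps_staircase mulr1.
Qed.

(** * Signed permutations as pairs of a sign set and a permutation *)

Section SignedPermutationFactors.
Variable n : nat.
Implicit Types (A : {set 'I_n}) (u : 'S_n).

(** Membership in [A] is tested on the value, not the position, so that [A] is the negative set of
    the inverse. The exclusive or makes the map odd. *)
Definition signed_perm_fun A u (x : signed n) : signed n :=
  (x.1 (+) (u x.2 \in A), u x.2).

Lemma signed_perm_fun_inj A u : injective (signed_perm_fun A u).
Proof. by move=> [a i] [b j] [+ /perm_inj Eij]; rewrite Eij => /addIb ->. Qed.

Definition signed_perm A u : {perm signed n} := perm (@signed_perm_fun_inj A u).

Definition signed_letter A (k : 'I_n) : int := signed_val (k \in A, k).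

Lemma signed_letter_inj A : injective (signed_letter A).
Proof. by move=> j k /signed_val_inj[]. Qed.

Lemma Des_signed_perm A u : Des (signed_perm A u) = word_des (signed_letter A) u.
Proof.
by apply/setP => i; rewrite !inE; apply: eq_existsb => j; rewrite /window !permE.
Qed.

Lemma signed_perm_inv A u i : (signed_perm A u)^-1%g (false, i) = (i \in A, u^-1%g i).
Proof.
apply: (canLR (permK _)); rewrite permE /signed_perm_fun /= permKV.
by rewrite addbb.
Qed.

Lemma Neg_signed_perm_inv A u : Neg (signed_perm A u)^-1%g = A.
Proof.
by apply/setP => i; rewrite inE /window signed_perm_inv /signed_val /=; case: (i \in A).
Qed.

Lemma signed_perm_inj : injective (fun Au => signed_perm Au.1 Au.2).
Proof.
move=> [A u] [B v] /= E; have /permP E' := E.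
congr (_, _); first by rewrite -(Neg_signed_perm_inv A u) E Neg_signed_perm_inv.
by apply/permP => i; have := E' (false, i); rewrite !permE => -[].
Qed.

Lemma hyperoctahedralE :
  hyperoctahedral n = [set signed_perm Au.1 Au.2 | Au in {: {set 'I_n} * 'S_n}].
Proof.
apply/setP => s; rewrite inE; apply/forallP/imsetP => [s_odd|[[A u] _ ->] x]; last first.
  by rewrite !permE /signed_perm_fun /signed_opp /= addNb.
(* If two absolute values agree, the images of [i] and [j] are equal or opposite; by oddness and
   injectivity of [s], the first case gives [i = j] and the second is absurd. *)
have f_inj : injective (fun i => (s (false, i)).2).
  move=> i j Eij; have /eqP s_opp := s_odd (false, j).
  have [E1|ne] := eqVneq (s (false, i)).1 (s (false, j)).1.
    have /perm_inj[] // : s (false, i) = s (false, j).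
    by rewrite [LHS]surjective_pairing E1 Eij -surjective_pairing.
  have /perm_inj[] // : s (false, i) = s (true, j).
  rewrite [RHS]s_opp [LHS]surjective_pairing /signed_opp Eij; congr (_, _).
  by move: ne; case: (s _).1; case: (s _).1.
pose u := perm f_inj; exists ([set k | (s (false, u^-1%g k)).1], u) => //=.
have Es i : s (false, i) = signed_perm [set k | (s (false, u^-1%g k)).1] u (false, i).
  by rewrite permE /signed_perm_fun inE permK /u permE /=; case: (s _).
apply/permP => -[[] i] //; have /eqP := s_odd (false, i).
by rewrite [in LHS]/signed_opp /= => ->; rewrite Es !permE.
Qed.

End SignedPermutationFactors.

Theorem theorem6p7 (n : nat) (hn : (0 < n)%N) :
  fps_infsum (partitions n)
    (fun la : n.-tuple nat =>
       (part_multinomial la)%:R * \prod_(i < n) fpsX i ^+ tnth la i)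
  = (\sum_(s in hyperoctahedral n)
        \prod_(i < n) fpsX i ^+ (des_from s i + neg_from (s^-1)%g i))
    / \prod_(i < n) (1 - \prod_(j < n | (j <= i)%N) fpsX j ^+ 2) :> fps n int.
Proof.
apply: (canRL (mulrK (denominator_unit n))).
rewrite hyperoctahedralE big_imset /=; last by move=> x y _ _; apply: signed_perm_inj.
pose F (A : {set 'I_n}) (u : 'S_n) : fps n int :=
  (\prod_(j in A) step_fps int j)
  * \prod_(j in word_des (signed_letter A) u) step_fps int j.
rewrite (eq_bigr (fun Au => F Au.1 Au.2)) => [|[A u] _ /=]; last first.
  under eq_bigr do rewrite exprD.
  rewrite big_split /= mulrC /des_from /neg_from.
  by rewrite !prod_expr_card_from Neg_signed_perm_inv Des_signed_perm.
rewrite -(pair_bigA _ F) /=.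
under [RHS]eq_bigr => A _.
  rewrite -mulr_sumr (sum_word_des (Ordinal hn) (@signed_letter_inj n A)).
  over.
rewrite -mulr_suml mulrCA -/(partition_fps n); congr (_ * _).
(* Expanding the product of the 1 + Q_i chooses the subset [A] of factors contributing Q_i. Each 1 +
   Q_i then pairs with 1 - Q_i to give the denominator factor. *)
have -> : \sum_(A : {set 'I_n}) \prod_(j in A) step_fps int j
    = \prod_(i < n) (1 + step_fps int i).
  under [RHS]eq_bigr do rewrite addrC.
  by rewrite bigA_distr; apply: eq_bigr => A _; rewrite -big_mkcond.
rewrite -big_split /=; apply: eq_bigr => i _.
by rewrite prodrXl mulrC -subr_sqr expr1n.
Qed.
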